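(* Let $G$ be a nontrivial countable residually finite abelian group and let $H$ be a countably infinite residually finite group. Then $G\wr H$ has a profinite action that is allosteric.
   Context: $G\wr H=c_{00}(H,G)\rtimes_\lambda H$, where $c_{00}(H,G)$ is the group of finitely supported functions $H\to G$ with pointwise operations, and $H$ acts by left translation $\lambda_h(f)(h')=f(h^{-1}h')$. Profinite action: given a countable infinite residually finite group $\Gamma$ and a decreasing sequence $\Gamma_1>\Gamma_2>\cdots$ of finite index subgroups with $\bigcap_n\Gamma_n=\{e\}$, the associated profinite action is the action of $\Gamma$ on $X=\varprojlim\Gamma/\Gamma_n$ (inverse limit of finite discrete spaces along the quotient maps) induced by the left translation actions on $\Gamma/\Gamma_n$. It carries the invariant ergodic Borel probability measure $\mu$ that is the inverse limit of the uniform probability measures on $\Gamma/\Gamma_n$. An action of a discrete group $\Gamma$ on a compact metrizable space with ergodic Borel probability measure $\mu$ is essentially free if the set of points with nontrivial stabilizer has $\mu$-measure zero; it is topologically free if for every $g\neq e$ the set of points not fixed by $g$ is dense; it is allosteric if it is topologically free but not essentially free. *)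

(* Defs.v *)
From HB Require Import structures.
From mathcomp Require Import all_boot all_order all_algebra all_fingroup.
From mathcomp Require Import finmap.
From mathcomp Require Import all_classical all_reals all_analysis.

Set Implicit Arguments.
Unset Strict Implicit.
Unset Printing Implicit Defensive.

Local Open Scope classical_set_scope.
Local Open Scope group_scope.

Definition residually_finite (Gamma : groupType) : Prop :=
  forall g : Gamma, g != 1 ->
    exists (Q : finGroupType) (f : {multiplicative Gamma -> Q}), f g != 1.

Definition nontrivial_group (Gamma : groupType) : Prop :=
  exists g : Gamma, g != 1.

Definition abelian_group (Gamma : groupType) : Prop :=
  forall g h : Gamma, commute g h.

(** ** Restricted wreath products *)

Section c00.
Variables (H G : groupType).

Definition fin_supported (f : H -> G) : Prop :=
  finite_set [set h | f h != 1].

Record c00 := C00 { c00_fun :> H -> G ; c00P : fin_supported c00_fun }.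

HB.instance Definition _ := gen_eqMixin c00.
HB.instance Definition _ := gen_choiceMixin c00.

Lemma c00_eqP (f g : c00) : (forall h, f h = g h) -> f = g.
Proof.
case: f g => f fS [g gS] /= /funext fg; rewrite fg in fS *.
by congr C00; exact: Prop_irrelevance.
Qed.

Fact c00_one_subproof : fin_supported (fun=> 1).
Proof.
rewrite /fin_supported /= (_ : [set _ | _] = set0) //.
by apply/seteqP; split => // h /=; rewrite eqxx.
Qed.

Fact c00_mul_subproof (f g : c00) : fin_supported (fun h => f h * g h).
Proof.
have fgS : finite_set ([set h | f h != 1] `|` [set h | g h != 1]).
  by rewrite finite_setU; split; exact: c00P.
apply: sub_finite_set fgS => h /=.
by have [->|] := eqVneq (f h) 1; [rewrite mul1g; right | left].
Qed.

Fact c00_inv_subproof (f : c00) : fin_supported (fun h => (f h)^-1).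
Proof. by apply: sub_finite_set (c00P f) => h /=; rewrite invg_eq1. Qed.

Fact c00_shift_subproof (k : H) (f : c00) :
  fin_supported (fun h => f (k^-1 * h)).
Proof.
apply: sub_finite_set (finite_image ( *%g k) (c00P f)) => h /= fh.
by exists (k^-1 * h); rewrite // mulVKg.
Qed.

Definition c00_one : c00 := C00 c00_one_subproof.
Definition c00_mul (f g : c00) : c00 := C00 (c00_mul_subproof f g).
Definition c00_inv (f : c00) : c00 := C00 (c00_inv_subproof f).

Fact c00_mulA : associative c00_mul.
Proof. by move=> f g k; apply: c00_eqP => h; exact: mulgA. Qed.
Fact c00_mul1 : left_id c00_one c00_mul.
Proof. by move=> f; apply: c00_eqP => h; exact: mul1g. Qed.
Fact c00_mulr1 : right_id c00_one c00_mul.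
Proof. by move=> f; apply: c00_eqP => h; exact: mulg1. Qed.
Fact c00_mulV : left_inverse c00_one c00_inv c00_mul.
Proof. by move=> f; apply: c00_eqP => h; exact: mulVg. Qed.
Fact c00_mulrV : right_inverse c00_one c00_inv c00_mul.
Proof. by move=> f; apply: c00_eqP => h; exact: mulgV. Qed.

HB.instance Definition _ := isGroup.Build c00
  c00_mulA c00_mul1 c00_mulr1 c00_mulV c00_mulrV.

Definition lambda (k : H) (f : c00) : c00 := C00 (c00_shift_subproof k f).

Lemma c00_oneE h : (1 : c00) h = 1. Proof. by []. Qed.
Lemma c00_mulE (f g : c00) h : (f * g) h = f h * g h. Proof. by []. Qed.
Lemma c00_invE (f : c00) h : f^-1 h = (f h)^-1. Proof. by []. Qed.
Lemma lambdaE k (f : c00) h : lambda k f h = f (k^-1 * h).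
Proof. by []. Qed.

Lemma lambda1 f : lambda 1 f = f.
Proof. by apply: c00_eqP => h; rewrite lambdaE invg1 mul1g. Qed.

Lemma lambdaM k l f : lambda (k * l) f = lambda k (lambda l f).
Proof. by apply: c00_eqP => h; rewrite !lambdaE invgM mulgA. Qed.

Lemma lambda_mul k : {morph lambda k : f g / f * g}.
Proof. by move=> f g; exact: c00_eqP. Qed.

Lemma lambda_one k : lambda k 1 = 1.
Proof. exact: c00_eqP. Qed.

End c00.

Section wreath.
Variables (G H : groupType).

(* A record rather than [c00 H G * H], which already carries the direct
   product group law. *)
Record wreath := Wreath { wr_base : c00 H G ; wr_top : H }.

HB.instance Definition _ := gen_eqMixin wreath.
HB.instance Definition _ := gen_choiceMixin wreath.

Definition wr_one : wreath := Wreath 1 1.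
Definition wr_mul (a b : wreath) : wreath :=
  Wreath (wr_base a * lambda (wr_top a) (wr_base b)) (wr_top a * wr_top b).
Definition wr_inv (a : wreath) : wreath :=
  Wreath (lambda (wr_top a)^-1 (wr_base a)^-1) (wr_top a)^-1.

Fact wr_mulA : associative wr_mul.
Proof.
by move=> [f h] [g k] [e l]; rewrite /wr_mul /= lambda_mul lambdaM !mulgA.
Qed.
Fact wr_mul1 : left_id wr_one wr_mul.
Proof. by move=> [f h]; rewrite /wr_mul /= lambda1 !mul1g. Qed.
Fact wr_mulr1 : right_id wr_one wr_mul.
Proof. by move=> [f h]; rewrite /wr_mul /= lambda_one !mulg1. Qed.
Fact wr_mulV : left_inverse wr_one wr_inv wr_mul.
Proof.
by move=> [f h]; rewrite /wr_mul /wr_inv /= -lambda_mul !mulVg lambda_one.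
Qed.
Fact wr_mulrV : right_inverse wr_one wr_inv wr_mul.
Proof.
by move=> [f h]; rewrite /wr_mul /wr_inv /= -lambdaM !mulgV lambda1 mulgV.
Qed.

HB.instance Definition _ := isGroup.Build wreath
  wr_mulA wr_mul1 wr_mulr1 wr_mulV wr_mulrV.

End wreath.

(** ** Actions on topological probability spaces *)

Notation borel X := (g_sigma_algebraType (@open X)).

Section actions.
Variables (R : realType) (Gamma : groupType) (X : ptopologicalType).
Variables (act : Gamma -> X -> X) (mu : probability (borel X) R).

Definition invariant_measure : Prop :=
  forall (g : Gamma) (A : set (borel X)), measurable A ->
    mu (act g @^-1` A) = mu A.

(* Invariance of [A] is required on the nose, which for countable [Gamma] is
   equivalent to invariance up to null sets. *)
Definition ergodic_measure : Prop :=
  invariant_measure /\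
  forall A : set (borel X), measurable A ->
    (forall g : Gamma, act g @^-1` A = A) -> mu A = 0%E \/ mu A = 1%E.

Definition essentially_free : Prop :=
  mu.-negligible [set x | exists2 g : Gamma, g != 1 & act g x = x].

Definition topologically_free : Prop :=
  forall g : Gamma, g != 1 -> dense [set x | act g x <> x].

Definition allosteric : Prop := topologically_free /\ ~ essentially_free.

End actions.

(** ** Profinite actions *)

Section cosets.
Variable Gamma : groupType.

Definition left_coset (K : set Gamma) (g : Gamma) : set Gamma :=
  [set g * k | k in K].

Definition left_cosets (K : set Gamma) : set (set Gamma) :=
  range (left_coset K).

Definition coset_space (K : set Gamma) : Type :=
  discrete_topology (left_cosets K).
HB.instance Definition _ K := DiscreteTopology.on (coset_space K).
HB.instance Definition _ (R : realType) K :=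
  PseudoMetric.copy (coset_space K)
    (discrete_topology (left_cosets K) : pseudoMetricType R).

Definition coset_val K (C : coset_space K) : set Gamma := \val C.

Definition coset_of_elt (K : set Gamma) (g : Gamma) : coset_space K :=
  SigSub (mem_set (imageT (left_coset K) g)).

Lemma coset_valP K (C : coset_space K) :
  exists g, coset_val C = left_coset K g.
Proof. by have := valP C; rewrite inE => -[g _ gK]; exists g. Qed.

Lemma coset_val_inj K : injective (@coset_val K).
Proof. by move=> C D; exact: val_inj. Qed.

Fact coset_translate_subproof (K : set Gamma) (g : Gamma) (C : coset_space K) :
  [set g * x | x in coset_val C] \in left_cosets K.
Proof.
have [h ->] := coset_valP C; apply/mem_set; exists (g * h) => //.
by rewrite /left_coset image_comp; apply: eq_imagel => k _ /=; rewrite mulgA.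
Qed.

Definition coset_translate (K : set Gamma) (g : Gamma) (C : coset_space K) :
  coset_space K := SigSub (coset_translate_subproof g C).

Lemma coset_val_translate K g (C : coset_space K) :
  coset_val (coset_translate g C) = [set g * x | x in coset_val C].
Proof. by []. Qed.

End cosets.

Record finite_index_chain (Gamma : groupType) := FiniteIndexChain {
  chain_set :> nat -> set Gamma ;
  chain_group : forall n, group_closed (mem (chain_set n)) ;
  chain_decr : forall n, chain_set n.+1 `<` chain_set n ;
  chain_index : forall n, finite_set (left_cosets (chain_set n)) ;
  chain_cap : \bigcap_n chain_set n = [set 1]
}.

Section profinite.
Variables (Gamma : groupType) (c : finite_index_chain Gamma).

Lemma chain1 n : c n 1.
Proof. by have [+ _] := chain_group c n; rewrite inE. Qed.

Lemma chainF n x y : c n x -> c n y -> c n (x * y^-1).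
Proof.
have [_ cF] := chain_group c n => cx cy.
by have := cF x y; rewrite !inE; exact.
Qed.

Lemma chainV n x : c n x -> c n x^-1.
Proof. by move=> cx; rewrite -[x^-1]mul1g; apply: chainF => //; exact: chain1. Qed.

Lemma chainM n x y : c n x -> c n y -> c n (x * y).
Proof. by move=> cx cy; rewrite -[y]invgK; apply: chainF => //; exact: chainV. Qed.

Lemma chain_sub n : c n.+1 `<=` c n.
Proof. by have /properW := chain_decr c n. Qed.

Lemma chain_quot_coset n g :
  [set x * k | x in left_coset (c n.+1) g & k in c n] = left_coset (c n) g.
Proof.
apply/seteqP; split => [_ [_ [l cl <-] [k ck <-]]|_ [k ck <-]].
  by exists (l * k); rewrite ?mulgA//; apply: chainM => //; exact: chain_sub.
exists g; last by exists k.
by exists 1; rewrite ?mulg1//; exact: chain1.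
Qed.

Fact chain_quot_subproof n (C : coset_space (c n.+1)) :
  [set x * k | x in coset_val C & k in c n] \in left_cosets (c n).
Proof.
by have [g ->] := coset_valP C; apply/mem_set; exists g; rewrite ?chain_quot_coset.
Qed.

Definition chain_quot n (C : coset_space (c n.+1)) : coset_space (c n) :=
  SigSub (chain_quot_subproof C).

Lemma chain_quotE n g :
  chain_quot (coset_of_elt (c n.+1) g) = coset_of_elt (c n) g.
Proof. by apply: coset_val_inj; exact: chain_quot_coset. Qed.

Lemma chain_quot_translate n g (C : coset_space (c n.+1)) :
  chain_quot (coset_translate g C) = coset_translate g (chain_quot C).
Proof.
apply: coset_val_inj => /=; apply/seteqP; split.
  move=> _ [_ [x Cx <-] [k ck <-]]; exists (x * k); rewrite ?mulgA//.
  by exists x => //; exists k.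
move=> _ [_ [x Cx [k ck <-]] <-]; exists (g * x); first by exists x.
by exists k; rewrite ?mulgA.
Qed.

Definition coset_product : Type := prod_topology (fun n => coset_space (c n)).
HB.instance Definition _ := Topological.on coset_product.
HB.instance Definition _ (R : realType) :=
  PseudoMetric.copy coset_product
    (prod_topology (fun n => coset_space (c n) : pseudoMetricType R)).

Definition coherent : set coset_product :=
  [set x | forall n, @chain_quot n (x n.+1) = x n].

Definition profinite_space : Type := coherent.
HB.instance Definition _ := Topological.on profinite_space.
HB.instance Definition _ (R : realType) :=
  PseudoMetric.copy profinite_space (coherent : pseudoMetricType R).

Definition pf_coord (n : nat) (x : profinite_space) : coset_space (c n) :=
  (\val x : coset_product) n.

Lemma pf_coordP n (x : profinite_space) : chain_quot (pf_coord n.+1 x) = pf_coord n x.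
Proof. by have := valP x; rewrite inE; exact. Qed.

Lemma pf_coord_inj (x y : profinite_space) :
  (forall n, pf_coord n x = pf_coord n y) -> x = y.
Proof.
by move=> xy; apply: val_inj; apply: functional_extensionality_dep => n; exact: xy.
Qed.

Definition Coherent (x : forall n, coset_space (c n))
    (xP : forall n, @chain_quot n (x n.+1) = x n) : profinite_space :=
  SigSub (mem_set (xP : coherent x)).

Definition profinite_of_elt (g : Gamma) : profinite_space :=
  @Coherent (fun n => coset_of_elt (c n) g) (fun n => chain_quotE n g).

HB.instance Definition _ := isPointed.Build profinite_space (profinite_of_elt 1).

Fact profinite_act_subproof g (x : profinite_space) n :
  chain_quot (coset_translate g (pf_coord n.+1 x)) = coset_translate g (pf_coord n x).
Proof. by rewrite chain_quot_translate pf_coordP. Qed.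

Definition profinite_act (g : Gamma) (x : profinite_space) : profinite_space :=
  Coherent (profinite_act_subproof g x).

Lemma pf_coord_act n g x : pf_coord n (profinite_act g x) = coset_translate g (pf_coord n x).
Proof. by []. Qed.

Lemma profinite_act1 x : profinite_act 1 x = x.
Proof.
apply: pf_coord_inj => n; apply: coset_val_inj.
rewrite pf_coord_act coset_val_translate.
by rewrite -[RHS]image_id; apply: eq_imagel => y _; rewrite mul1g.
Qed.

Lemma profinite_actM g h x :
  profinite_act (g * h) x = profinite_act g (profinite_act h x).
Proof.
apply: pf_coord_inj => n; apply: coset_val_inj.
by rewrite !pf_coord_act !coset_val_translate image_comp; apply: eq_imagel => y _ /=; rewrite mulgA.
Qed.

Lemma pf_coord_continuous n : continuous (@pf_coord n).
Proof.
move=> x; apply: (@continuous_comp profinite_space coset_product (coset_space (c n))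
  (fun y => \val y) (fun y => y n)).
- exact: initial_continuous.
- exact: (@proj_continuous nat (fun n => coset_space (c n)) n).
Qed.

Lemma profinite_cvgP (F : set_system profinite_space) (x : profinite_space) :
  Filter F -> (F --> x) <-> (forall n, F [set y | pf_coord n y = pf_coord n x]).
Proof.
move=> FF; split=> [Fx n|Fx].
  apply: (Fx [set y | pf_coord n y = pf_coord n x]).
  have xn : nbhs (pf_coord n x) [set pf_coord n x].
    by rewrite nbhs_principalE; exact/principal_filterP.
  exact: pf_coord_continuous xn.
have Fval : ((fun y : profinite_space => \val y : coset_product) @ F) -->
    (\val x : coset_product).
  apply/cvg_sup => n A; rewrite nbhsE => -[_ [[B _ <-] Bx] BA].
  apply: (@filterS _ F _ [set y | pf_coord n y = pf_coord n x]) (Fx n) => y xy.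
  by apply: BA; rewrite /= -/(pf_coord n y) xy.
move=> A; rewrite nbhsE => -[_ [[B oB <-] Bx] BA].
by apply: filterS BA _; apply: Fval; exact: open_nbhs_nbhs.
Qed.

Lemma nbhs_pf_coord n (x : profinite_space) :
  nbhs x [set y | pf_coord n y = pf_coord n x].
Proof. by have /profinite_cvgP := @cvg_id _ (nbhs x); exact. Qed.

Lemma profinite_act_continuous g : continuous (profinite_act g).
Proof.
move=> x.
have FF : Filter (profinite_act g @ x) by apply: fmap_filter; exact: nbhs_filter.
apply/profinite_cvgP => n; apply: filterS (nbhs_pf_coord n x) => y /= yx.
by rewrite !pf_coord_act yx.
Qed.

Lemma finite_coset_space n : finite_set [set: coset_space (c n)].
Proof.
apply: (@card_le_finite _ _ _ (left_cosets (c n))); last exact: chain_index.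
by have := card_setT (left_cosets (c n)); rewrite card_eq_le => /andP[].
Qed.

(* Together with the pseudometric instance above, the next two lemmas make
   [profinite_space] a compact metrizable space. *)
Lemma profinite_compact : compact [set: profinite_space].
Proof.
rewrite compact_ultra => F FU _.
have FC n : exists C, F [set y | pf_coord n y = C].
  have [//|p [_ Fp]] := finite_compact (finite_coset_space n) (F := pf_coord n @ F).
    exact: filterT.
  exists p; have [//|FN] := in_ultra_setVsetC [set y | pf_coord n y = p] FU.
  have [] := Fp (~` [set p]) [set p] FN.
    by rewrite nbhs_principalE; exact/principal_filterP.
  by move=> q [].
pose x n := projT1 (cid (FC n)); have xP n := projT2 (cid (FC n)).
have xc n : @chain_quot n (x n.+1) = x n.
  have [y /= [yn1 yn]] := filter_ex (filterI (xP n.+1) (xP n)).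
  have <- : pf_coord n.+1 y = x n.+1 by [].
  have <- : pf_coord n y = x n by [].
  exact: pf_coordP.
by exists (Coherent xc); split => //; apply/profinite_cvgP.
Qed.

Lemma profinite_hausdorff : hausdorff_space profinite_space.
Proof.
move=> x y xy; apply: pf_coord_inj => n.
by have [z [/= <- <-]] := xy _ _ (nbhs_pf_coord n x) (nbhs_pf_coord n y).
Qed.

Definition inverse_limit_of_uniform (R : realType)
    (mu : probability (borel profinite_space) R) : Prop :=
  forall n (A : set (coset_space (c n))),
    mu (pf_coord n @^-1` A) =
      ((#|` fset_set A|)%:R / (#|` fset_set [set: coset_space (c n)]|)%:R)%R%:E.

End profinite.

(* Main.v *)
Require Import Defs.
From HB Require Import structures.
From mathcomp Require Import all_boot all_order all_algebra all_fingroup.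
From mathcomp Require Import finmap.
From mathcomp Require Import all_classical all_reals all_analysis.

(** Fix [a != 1] in [G].  Choose finite-index normal subgroups [K_i] of [H] of
    index at least [2^(i+2)] and [L_i] of [G], each sequence eventually avoiding
    every nontrivial element, and let [e_i] run through [H] hitting every element
    infinitely often.  The pairs [(b, h)] with [h] in [K_i] and
    [prod_(x in e_i K_i) b(x)] in [L_i] form a finite-index subgroup [D_i] of
    [G wr H], and the [D_i] intersect trivially: if [b(x) != 1], then for some
    large [i] with [e_i = x] the coset [x K_i] meets the support of [b] only in [x].
    The chain consists of the finite intersections of the [D_i].

    Since the chain intersects trivially, the dense image of the group in the
    inverse limit consists of points with trivial stabilizer, so the action is
    topologically free.  As [G] is abelian, conjugating [a] placed at [1] by
    [(b, h)] gives [a] placed at [h^-1], which lies in [D_i] unless [h^-1] is in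
    [e_i K_i].  Hence this element moves only points of a set of measure at most
    [sum_i 1 / [H : K_i] <= 1/2].

    The Haar measure is the image of Lebesgue measure on [[0, 1[] under the map
    reading the coset at level [n] off [floor (t N_n)], where the [N_n] cosets are
    numbered lexicographically. *)

Set Implicit Arguments.
Unset Strict Implicit.
Unset Printing Implicit Defensive.

Import Order.TTheory GRing.Theory Num.Theory.

Local Open Scope classical_set_scope.
Local Open Scope group_scope.

(** * Finite-index normal subgroups *)

Section finite_quotients.
Variable Gamma : groupType.
Implicit Types (K : set Gamma) (x y : Gamma).

(** Normal subgroups of finite index, presented as kernels: intersections then come from product
    groups, and membership is an equation in a finite group. *)
Definition finite_quotient_kernel K : Prop :=
  exists (Q : finGroupType) (f : Gamma -> Q),
    {morph f : x y / x * y} /\ K = [set x | f x = 1].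

Lemma morph_one (Q : groupType) (f : Gamma -> Q) :
  {morph f : x y / x * y} -> f 1 = 1.
Proof. by move=> fM; apply: (mulgI (f 1)); rewrite -fM !mulg1. Qed.

Lemma morph_inv (Q : groupType) (f : Gamma -> Q) :
  {morph f : x y / x * y} -> {morph f : x / x^-1}.
Proof.
by move=> fM x; apply: (mulgI (f x)); rewrite -fM !mulgV morph_one.
Qed.

Lemma finite_quotient_kernelT : finite_quotient_kernel setT.
Proof.
exists {perm bool}, (fun=> 1); split=> [x y|]; first by rewrite mulg1.
by apply/seteqP; split.
Qed.

Lemma finite_quotient_kernelI K K' :
  finite_quotient_kernel K -> finite_quotient_kernel K' ->
  finite_quotient_kernel (K `&` K').
Proof.
move=> [Q [f [fM ->]]] [Q' [f' [f'M ->]]].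
exists (Q * Q')%type, (fun x => (f x, f' x)); split=> [x y|].
  by rewrite fM f'M.
by apply/seteqP; split=> x /= [-> ->].
Qed.

Lemma finite_quotient_kernel_bigcap (I : eqType) (s : seq I) (F : I -> set Gamma) :
  (forall i, finite_quotient_kernel (F i)) ->
  finite_quotient_kernel (\bigcap_(i in [set` s]) F i).
Proof.
move=> FK; elim: s => [|i s IHs].
  by rewrite set_nil bigcap_set0; exact: finite_quotient_kernelT.
have -> : [set` i :: s] = i |` [set` s].
  by apply/seteqP; split=> j /=; rewrite inE => /predU1P.
by rewrite bigcap_setU1; apply: finite_quotient_kernelI.
Qed.

Section theory.
Variable K : set Gamma.
Hypothesis finK : finite_quotient_kernel K.

Lemma finite_quotient_kernel1 : K 1.
Proof. by have [Q [f [fM ->]]] := finK; exact: morph_one. Qed.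

Lemma finite_quotient_kernelV x : K x -> K x^-1.
Proof.
have [Q [f [fM ->]]] := finK => /= fx.
by rewrite morph_inv// fx invg1.
Qed.

Lemma finite_quotient_kernelM x y : K x -> K y -> K (x * y).
Proof.
have [Q [f [fM ->]]] := finK => /= fx fy.
by rewrite fM fx fy mulg1.
Qed.

End theory.

Lemma residually_finite_kernels : residually_finite Gamma ->
  exists N : Gamma -> set Gamma,
    forall x, finite_quotient_kernel (N x) /\ (x != 1 -> ~ N x x).
Proof.
move=> rf; suff /choice[N NP] : forall x, exists K,
    finite_quotient_kernel K /\ (x != 1 -> ~ K x) by exists N.
move=> x; have [->|/rf[Q [f fx]]] := eqVneq x 1.
  by exists setT; split=> //; exact: finite_quotient_kernelT.
exists [set y | f y = 1]; split; last by move=> _ /= /eqP; exact/negP.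
by exists Q, f; split => // y z; exact: gmulfM.
Qed.

End finite_quotients.

Lemma near_finite_forall (T : choiceType) (A : set T) (P : nat -> T -> Prop) :
  finite_set A -> (forall x, A x -> \forall n \near \oo, P n x) ->
  \forall n \near \oo, forall x, A x -> P n x.
Proof.
move=> /finite_fsetP[X ->] XP.
have := @filter_bigI nat T X (fun x => [set n | P n x]) \oo eventually_filter XP.
by apply: filterS => n XPn x Xx; exact: XPn.
Qed.

Lemma infinite_nat_inj (T : Type) :
  infinite_set [set: T] -> exists t : nat -> T, injective t.
Proof.
elim/Ppointed: T => T; first by rewrite emptyE => /(_ (finite_set0 _)).
by move=> /infiniteP/pcard_leTP/injPex[t tinj]; exists t => j k; apply: tinj; rewrite inE.
Qed.

(** * Sequences of kernels in a countable residually finite group *)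

Section kernel_sequences.
Variable Gamma : groupType.
Hypotheses (Gamma_countable : countable [set: Gamma])
  (Gamma_rf : residually_finite Gamma).

Lemma countable_enum : exists e : nat -> Gamma, forall x, exists n, e n = x.
Proof.
have [f finj] := elimT (countable_injP _) Gamma_countable.
have : forall n, exists x, (exists y, f y = n) -> f x = n.
  move=> n; have [[y fy]|ny] := pselect (exists y, f y = n); first by exists y.
  by exists 1 => /ny.
move=> /choice[e eP]; exists e => x; exists (f x).
by apply: (finj _ x); rewrite ?inE//; apply: eP; exists x.
Qed.

(* [logn 2] takes every value infinitely often. *)
Lemma countable_recurrent_enum :
  exists e : nat -> Gamma, forall x n, exists2 m, (n <= m)%N & e m = x.
Proof.
have [e eP] := countable_enum; exists (e \o logn 2) => x n.
have [k <-] := eP x.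
exists (2 ^ k * n.*2.+1)%N; last first.
  rewrite /= lognM ?expn_gt0// pfactorK// logn_coprime ?addn0//.
  by rewrite coprime2n /= odd_double.
rewrite (leq_trans _ (leq_pmull _ _)) ?expn_gt0//.
by rewrite -addnn -addnS leq_addr.
Qed.

(** The [n]-th kernel is the intersection of those attached to the first [n] enumerated elements, so
    a nontrivial element is excluded once it has been listed. *)
Lemma exhausting_kernels : exists L : nat -> set Gamma,
  (forall n, finite_quotient_kernel (L n)) /\
  (forall x, x != 1 -> \forall n \near \oo, ~ L n x).
Proof.
have [N NP] := residually_finite_kernels Gamma_rf.
have [e eP] := countable_enum.
exists (fun n => \bigcap_(i in [set` iota 0 n]) N (e i)); split=> [n|x x1].
  by apply: finite_quotient_kernel_bigcap => i; have [] := NP (e i).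
have [k ekx] := eP x; exists k.+1 => // n /= kn Lx.
have [_ /(_ x1)] := NP x; apply; rewrite -[N x]/(N x) -{1}ekx; apply: Lx.
by rewrite /= mem_iota.
Qed.

(** The last clause is the usable form of index at least [m n]: the first [m n] terms of [t] lie in
    distinct cosets. It is obtained by also intersecting with kernels that avoid the finitely many
    quotients [(t j)^-1 * t k]. *)
Lemma large_index_kernels (m : nat -> nat) : infinite_set [set: Gamma] ->
  exists (K : nat -> set Gamma) (t : nat -> Gamma),
  [/\ forall n, finite_quotient_kernel (K n),
      forall x, x != 1 -> \forall n \near \oo, ~ K n x &
      forall n j k, (j < m n)%N -> (k < m n)%N -> j != k -> ~ K n ((t j)^-1 * t k)].
Proof.
move=> inf; have [N NP] := residually_finite_kernels Gamma_rf.
have [L [Lfin Lnear]] := exhausting_kernels.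
have [t t_inj] := infinite_nat_inj inf.
exists (fun n => L n `&` \bigcap_(i in [set` allpairs pair (iota 0 (m n)) (iota 0 (m n))])
  N ((t i.1)^-1 * t i.2)), t; split=> [n|x x1|n j k jm km jk [_]].
- apply: finite_quotient_kernelI => //.
  by apply: finite_quotient_kernel_bigcap => i; have [] := NP ((t i.1)^-1 * t i.2).
- by apply: filterS (Lnear x x1) => n Lx [].
- have [_] := NP ((t j)^-1 * t k).
  move=> /[swap] /(_ (j, k)) NK NN; apply: NN; last first.
    by apply: NK; rewrite /=; apply/allpairsP; exists (j, k); rewrite /= !mem_iota.
  by apply: contra_neq jk => /mulg1_eq; rewrite invgK => /t_inj.
Qed.

End kernel_sequences.

(** * Products of a finitely supported function over a block *)

Section abelian_product.
Variables (G : groupType) (G_abelian : abelian_group G).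

(* Carrying the commutativity proof as an argument makes [fsbig] usable on
   the abelian group [G]. *)
Definition abelian_mul of abelian_group G : G -> G -> G := @mul G.

HB.instance Definition _ := Monoid.isComLaw.Build G 1 (abelian_mul G_abelian)
  (@mulgA G) G_abelian (@mul1g G).

Variable H : groupType.
Implicit Types (A : set H) (b c : c00 H G).

Definition block_prod A b : G := \big[abelian_mul G_abelian/1]_(x \in A) b x.

Lemma block_prodM A : {morph block_prod A : b c / b * c}.
Proof.
move=> b c.
(* The three products have different supports; all are rewritten over the part of [A] inside the
   common finite set [S]. *)
pose S := [set x | b x != 1] `|` [set x | c x != 1].
have finS : finite_set (A `&` S).
  by apply: finite_setIr; rewrite finite_setU; split; exact: c00P.
have restrict (d : c00 H G) : (forall x, ~ S x -> d x = 1) ->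
    block_prod A d = \big[abelian_mul G_abelian/1]_(x \in A `&` S) d x.
  move=> dS; apply/esym/fsbig_widen; first exact: subIsetl.
  by move=> x [Ax /not_andP[//|/dS]].
have bS x : ~ S x -> b x = 1 by move=> /not_orP[/negP/negPn/eqP].
have cS x : ~ S x -> c x = 1 by move=> /not_orP[_ /negP/negPn/eqP].
rewrite !restrict//; first exact: (fsbig_split (abelian_mul G_abelian) _ _ finS).
by move=> x Sx; rewrite c00_mulE bS// cS// mulg1.
Qed.

Lemma block_prod_lambda A k b :
  block_prod A (lambda k b) = block_prod [set x | A (k * x)] b.
Proof.
rewrite /block_prod (reindex_fsbig ( *%g k) [set x | A (k * x)]).
  by apply: eq_fsbigr => x _; rewrite lambdaE mulKg.
split=> [x //|x y _ _ /mulgI //|x Ax].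
by exists (k^-1 * x); rewrite /= mulVKg.
Qed.

Lemma block_prod_eq1 A b : (forall x, A x -> b x = 1) -> block_prod A b = 1.
Proof. exact: fsbig1. Qed.

Lemma block_prod_single A b h : A h -> (forall x, A x -> x != h -> b x = 1) ->
  block_prod A b = b h.
Proof.
move=> Ah bA; rewrite -[RHS](fsbig_set1 (abelian_mul G_abelian) h b).
apply/esym/fsbig_widen; first by move=> x ->.
by move=> x [Ax /eqP xh]; exact: bA.
Qed.

End abelian_product.

(** * Finite index through maps to finite types *)

Section finite_index.
Variable Gamma : groupType.
Implicit Types D : set Gamma.

(** For a subgroup [D] this says that each fibre of [phi] lies in a single left coset, hence that
    the index is finite. Pairing the maps handles intersections. *)
Definition finitely_separated D : Prop :=
  exists (T : finType) (phi : Gamma -> T),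
    forall x y, phi x = phi y -> D (x^-1 * y).

Lemma finitely_separated_bigcap (D : nat -> set Gamma) n :
  (forall i, finitely_separated (D i)) ->
  finitely_separated (\bigcap_(i in `I_n) D i).
Proof.
move=> DT; elim: n => [|n [T [phi phiP]]].
  by exists unit, (fun=> tt) => x y _ i.
have [U [psi psiP]] := DT n.
exists (T * U)%type, (fun x => (phi x, psi x)) => x y [/phiP xyT /psiP xyU] i /=.
by rewrite ltnS leq_eqVlt => /predU1P[->//|]; exact: xyT.
Qed.

Lemma finitely_separated_index D :
  group_closed (mem D) -> finitely_separated D -> finite_set (left_cosets D).
Proof.
move=> [D1 DF] [T [phi phiP]].
have DV x : D x -> D x^-1.
  by move=> Dx; have := DF 1 x; rewrite !inE mul1g; apply=> //; rewrite inE in D1.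
have DM x y : D x -> D y -> D (x * y).
  by move=> Dx /DV Dy; have := DF x y^-1; rewrite !inE invgK; apply.
have coset_eq x y : D (x^-1 * y) -> left_coset D x = left_coset D y.
  move=> Dxy; apply/seteqP; split=> _ [k Dk <-].
    exists ((x^-1 * y)^-1 * k); first by apply: DM => //; exact: DV.
    by rewrite invgM invgK !mulgA mulgV mul1g.
  by exists (x^-1 * y * k); [exact: DM|rewrite !mulgA mulgV mul1g].
pose g t := if pselect (exists x, phi x = t) is left ex then left_coset D (projT1 (cid ex))
            else D.
apply: (@sub_finite_set _ _ (range g)); last exact: finite_image.
move=> _ [x _ <-]; exists (phi x) => //; rewrite /g.
case: pselect => [ex|[]]; last by exists x.
by apply: coset_eq; apply: phiP; case: cid.
Qed.

(** If [D] had no nontrivial element, [phi] would be injective and [Gamma] finite. *)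
Lemma finitely_separated_nontrivial D :
  infinite_set [set: Gamma] -> finitely_separated D -> exists2 x, D x & x != 1.
Proof.
move=> inf [T [phi phiP]]; apply: contrapT => Dtriv; apply: inf.
pose g t := if pselect (exists x, phi x = t) is left ex then projT1 (cid ex) else 1.
apply: (@sub_finite_set _ _ (range g)); last exact: finite_image.
move=> x _; exists (phi x) => //; rewrite /g.
case: pselect => [ex|[]]; last by exists x.
case: cid => y /= /phiP Dyx; apply: contrapT => yx; apply: Dtriv.
exists (y^-1 * x) => //; apply: contra_not_neq yx => /mulg1_eq.
by rewrite invgK.
Qed.

End finite_index.

(** * The subgroups [D_i] of the wreath product *)

Section block_subgroups.
Variables (G H : groupType) (G_abelian : abelian_group G).
Variables (K : set H) (r : H) (L : set G).
Hypotheses (finK : finite_quotient_kernel K) (finL : finite_quotient_kernel L).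

Definition block_subgroup : set (wreath G H) :=
  [set w | K (wr_top w) /\
    L (block_prod G_abelian [set x | K (r^-1 * x)] (wr_base w))].

(** As [K] is normal, translation by an element of [K] preserves the block [r K], so the top
    components do not disturb the block product. *)
Lemma block_subgroup_closed : group_closed (mem block_subgroup).
Proof.
have blockK u : K u -> [set x | K (r^-1 * (u * x))] = [set x | K (r^-1 * x)].
  have [Q [f [fM ->]]] := finK => /= fu.
  by apply/seteqP; split=> x /=; rewrite !fM fu mul1g.
split.
  rewrite inE; split; first exact: finite_quotient_kernel1.
  by rewrite block_prod_eq1//; exact: finite_quotient_kernel1.
move=> [b h] [c k]; rewrite !inE => -[/= Kh Lb] [/= Kk Lc].
have Khk : K (h * k^-1).
  by apply: finite_quotient_kernelM => //; exact: finite_quotient_kernelV.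
split=> //=; rewrite block_prodM -lambdaM block_prod_lambda.
apply: finite_quotient_kernelM => //=.
rewrite (blockK _ Khk) (morph_inv (block_prodM _ _)).
exact: finite_quotient_kernelV.
Qed.

(** The separating map records the top component modulo [K] and the block products modulo [L] over
    all cosets of [K]. A single block would not do: in a quotient of two elements, the action of
    [h^-1] replaces [r K] by [h r K]. *)
Lemma block_subgroup_separated : finitely_separated block_subgroup.
Proof.
have [Q [f [fM Kf]]] := finK; have [P [psi [psiM Lpsi]]] := finL.
exists (Q * {ffun Q -> P})%type, (fun w => (f (wr_top w),
  [ffun q => psi (block_prod G_abelian [set x | f x = q] (wr_base w))])).
move=> [b h] [c k] /= [fhk /ffunP bc].
have fV := morph_inv fM.
split; first by rewrite /= Kf /= fM fV fhk mulVg.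
rewrite /= -lambda_mul block_prod_lambda Lpsi /=.
have -> : [set x | K (r^-1 * (h^-1 * x))] = [set x | f x = f (h * r)].
  apply/seteqP; split=> x; rewrite /= Kf /= !fM !fV.
    by move=> /mulg1_eq; rewrite invgK => fr; rewrite fr mulVKg.
  by move=> ->; rewrite mulKg mulVg.
have := bc (f (h * r)); rewrite !ffunE => bchr.
by rewrite block_prodM psiM (morph_inv (block_prodM _ _)) (morph_inv psiM) bchr mulVg.
Qed.

End block_subgroups.

(** * Elements supported at one point *)

Section delta.
Variables (G H : groupType).

Fact c00_delta_subproof (h : H) (a : G) :
  fin_supported (fun x => if x == h then a else 1).
Proof.
apply: (@sub_finite_set _ _ [set h]); last exact: finite_set1.
by move=> x /=; have [->|_ /eqP] := eqVneq x h.
Qed.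

Definition c00_delta h a : c00 H G := C00 (c00_delta_subproof h a).

Lemma wreath_delta_conj (G_abelian : abelian_group G) (a : G) (w : wreath G H) :
  w^-1 * Wreath (c00_delta 1 a) 1 * w = Wreath (c00_delta (wr_top w)^-1 a) 1.
Proof.
case: w => b h; rewrite /mul /= /inv /= /wr_mul /wr_inv /= mulg1 mulVg.
congr Wreath; apply: c00_eqP => x; rewrite !c00_mulE !lambdaE /= invgK.
rewrite -mulgA (G_abelian _ (b _)) mulKg.
by congr (if _ then _ else _); apply/eqP/eqP => [/mulg1_eq|->]; rewrite ?mulgV.
Qed.

Lemma block_subgroup_delta (G_abelian : abelian_group G) (K : set H) r (L : set G) a h :
  finite_quotient_kernel K -> finite_quotient_kernel L ->
  ~ block_subgroup G_abelian K r L (Wreath (c00_delta h a) 1) -> K (r^-1 * h).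
Proof.
move=> finK finL; apply: contra_notP => Kh; split=> /=.
  exact: finite_quotient_kernel1.
rewrite block_prod_eq1; first exact: finite_quotient_kernel1.
by move=> x Kx /=; case: eqP => // xh; rewrite -xh in Kh.
Qed.

End delta.

(** * Construction of the chain *)

Lemma finite_index_chain_subsequence (Gamma : groupType) (D : nat -> set Gamma) :
  infinite_set [set: Gamma] ->
  (forall i, group_closed (mem (D i))) -> (forall i, finitely_separated (D i)) ->
  (forall x, (forall i, D i x) -> x = 1) ->
  exists c : finite_index_chain Gamma,
    (forall i, c i.+1 `<=` D i) /\
    forall n, exists N, forall x, ~ c n x -> exists2 i, (i < N)%N & ~ D i x.
Proof.
move=> inf Dgroup Dsep Dcap; pose C n := \bigcap_(i in `I_n) D i.
have CS m n : (m <= n)%N -> C n `<=` C m.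
  by move=> mn x Cx i im; apply: Cx; exact: leq_trans im mn.
(* The [C n] need not decrease strictly. But [C n] has finite index in an infinite group, so it
   contains some [x != 1], which a later intersection excludes; iterating [g] selects a strictly
   decreasing subsequence. *)
have /choice[g gP] : forall n, exists m, (n < m)%N /\ exists2 x, C n x & ~ C m x.
  move=> n.
  have [x Cx x1] := finitely_separated_nontrivial inf (finitely_separated_bigcap n Dsep).
  have [i Dix] : exists i, ~ D i x.
    by apply/existsNP => Dx; move: x1; rewrite (Dcap _ Dx) eqxx.
  exists (maxn n i).+1; split; first by rewrite ltnS leq_maxl.
  by exists x => // /(_ i); rewrite /= ltnS leq_maxr => /(_ isT).
pose u n := iter n g 0%N.
have u_ge n : (n <= u n)%N.
  by elim: n => // n IHn; apply: leq_ltn_trans IHn _; have [] := gP (u n).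
have Cgroup n : group_closed (mem (C n)).
  split=> [|x y]; rewrite !inE; first by move=> i _; have [+ _] := Dgroup i; rewrite inE.
  move=> Cx Cy i ilt; have [_ /(_ x y)] := Dgroup i; rewrite !inE; apply; [exact: Cx|exact: Cy].
have Cdecr n : C (u n.+1) `<` C (u n).
  have [lt_u [x Cx Cx']] := gP (u n).
  split; first by apply: CS; exact: ltnW.
  by move=> /(_ x Cx)/Cx'.
have Cindex n : finite_set (left_cosets (C (u n))).
  by apply: finitely_separated_index; [exact: Cgroup|exact: finitely_separated_bigcap].
have Ccap : \bigcap_n C (u n) = [set 1].
  apply/seteqP; split=> [x Cx|_ -> n _]; last by have [+ _] := Cgroup (u n); rewrite inE.
  by apply: Dcap => i; apply: (Cx i.+1) => //; exact: u_ge.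
exists (FiniteIndexChain (fun n => Cgroup (u n)) Cdecr Cindex Ccap); split=> [i|n] /=.
  by move=> x; apply; exact: u_ge.
exists (u n) => x; rewrite /C => /existsNP[i]; rewrite not_implyE => -[? ?].
by exists i.
Qed.

Lemma wreath_chain (G H : groupType) (a : G) :
  countable [set: G] -> residually_finite G -> abelian_group G ->
  countable [set: H] -> infinite_set [set: H] -> residually_finite H ->
  exists (c : finite_index_chain (wreath G H)) (K : nat -> set H) (e t : nat -> H),
  [/\ forall i, finite_quotient_kernel (K i),
      forall i j k, (j < 2 ^ i.+2)%N -> (k < 2 ^ i.+2)%N -> j != k ->
        ~ K i ((t j)^-1 * t k),
      forall i w, c i.+1 w -> K i (wr_top w) &
      forall n, exists N, forall h, ~ c n (Wreath (c00_delta h a) 1) ->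
        exists2 i, (i < N)%N & K i ((e i)^-1 * h)].
Proof.
move=> cntG rfG abG cntH infH rfH.
have [L [finL nearL]] := exhausting_kernels cntG rfG.
have [K [t [finK nearK tK]]] :=
  large_index_kernels cntH rfH (fun i => 2 ^ i.+2)%N infH.
have [e eP] := countable_recurrent_enum cntH.
pose D i := block_subgroup abG (K i) (e i) (L i).
have inf : infinite_set [set: wreath G H].
  apply: contra_not infH => fin.
  apply: (@sub_finite_set _ _ (range (@wr_top G H))); last exact: finite_image.
  by move=> h _; exists (Wreath 1 h).
have Dcap w : (forall i, D i w) -> w = 1.
  case: w => b h Dw.
  have h1 : h = 1.
    apply: contrapT => /eqP/nearK[N _ NK].
    by apply: (NK N) => /=; have [] := Dw N.
  congr Wreath; last exact: h1.
  apply: c00_eqP => x; rewrite c00_oneE; apply: contrapT => /eqP bx.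
  (* Both conditions hold eventually, and [e] returns to [x] arbitrarily late; at such an index the
     block product is just [b x], outside [L]. *)
  have : \forall n \near \oo, ~ L n (b x) /\
      forall y, [set y | b y != 1] y -> y != x -> ~ K n (x^-1 * y).
    near=> n; split; first by near: n; exact: nearL.
    near: n; apply: near_finite_forall; first exact: c00P.
    move=> y _; have [->|yx] := eqVneq y x; first by near=> n.
    have xy : x^-1 * y != 1 by apply: contra_neq yx => /mulg1_eq; rewrite invgK.
    by apply: filterS (nearK _ xy) => n.
  move=> [N _ NP]; have [m Nm emx] := eP x N.
  have [Lm Km] := NP m Nm; apply: Lm.
  have [_] := Dw m; rewrite emx /= (@block_prod_single _ _ _ _ _ x)//=.
    by rewrite mulVg; exact: finite_quotient_kernel1.
  by move=> y Ky yx; apply: contrapT => /eqP/Km; exact.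
have [|i|c [cD Dc]] := finite_index_chain_subsequence inf _ _ Dcap.
- by move=> i; exact: block_subgroup_closed.
- exact: block_subgroup_separated.
exists c, K, e, t; split=> // [i w /cD[]//|n].
have [N NP] := Dc n; exists N => h /NP[i iN Di].
by exists i => //; exact: block_subgroup_delta Di.
Unshelve. all: by end_near.
Qed.

(** * Cylinders and the Borel sets of the inverse limit *)

Section profinite_cylinders.
Variables (Gamma : groupType) (c : finite_index_chain Gamma).
Local Notation X := (profinite_space c).

Lemma chain_subset m n : (m <= n)%N -> c n `<=` c m.
Proof.
move=> /subnK <-; elim: (n - m)%N => // k IHk.
by apply: subset_trans IHk; exact: chain_sub.
Qed.

Lemma coset_of_elt_eqP n x y :
  coset_of_elt (c n) x = coset_of_elt (c n) y <-> c n (x^-1 * y).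
Proof.
split=> [/(congr1 (@coset_val _ _)) xy|cxy].
  have : left_coset (c n) y y by exists 1; [exact: chain1|rewrite mulg1].
  by rewrite -[left_coset _ _]xy => -[k ck <-]; rewrite mulKg.
apply: coset_val_inj; apply/seteqP; split=> _ [k ck <-].
  exists ((x^-1 * y)^-1 * k); first by apply: chainM => //; exact: chainV.
  by rewrite invgM invgK !mulgA mulgV mul1g.
by exists (x^-1 * y * k); [exact: chainM|rewrite !mulgA mulgV mul1g].
Qed.

Lemma coset_of_elt_onto n (C : coset_space (c n)) : exists y, C = coset_of_elt (c n) y.
Proof. by have [y Cy] := coset_valP C; exists y; exact: coset_val_inj. Qed.

Lemma coset_translate_elt n g y :
  coset_translate g (coset_of_elt (c n) y) = coset_of_elt (c n) (g * y).
Proof.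
apply: coset_val_inj; rewrite coset_val_translate.
rewrite -[coset_val _]/(left_coset (c n) y) -[RHS]/(left_coset (c n) (g * y)).
rewrite /left_coset image_comp.
by apply: eq_imagel => k _ /=; rewrite mulgA.
Qed.

(** Reduces computations with finitely many coordinates to computations in [Gamma]; a representative
    at level [n] serves all lower levels by coherence. *)
Lemma pf_coord_representative (x : X) n :
  exists y, forall m, (m <= n)%N -> pf_coord m x = coset_of_elt (c m) y.
Proof.
have [y yn] := coset_of_elt_onto (pf_coord n x).
exists y; elim: n yn => [|n IHn] xn m; first by rewrite leqn0 => /eqP ->.
rewrite leq_eqVlt => /predU1P[->//|]; apply: IHn.
by rewrite -pf_coordP xn chain_quotE.
Qed.

Lemma pf_coord_le m n (x y : X) :
  (m <= n)%N -> pf_coord n x = pf_coord n y -> pf_coord m x = pf_coord m y.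
Proof.
move=> mn xy; have [g xg] := pf_coord_representative x n.
have [h yh] := pf_coord_representative y n.
rewrite xg// yh//; apply/coset_of_elt_eqP; apply: chain_subset mn _ _.
by apply/coset_of_elt_eqP; rewrite -xg// -yh.
Qed.

Definition cylinder n (C : coset_space (c n)) : set X := pf_coord n @^-1` [set C].

Lemma cylinder_open n (C : coset_space (c n)) : open (cylinder C).
Proof.
rewrite openE => x xC; apply: filterS (nbhs_pf_coord n x) => y yx.
by rewrite /cylinder /= yx.
Qed.

Lemma measurable_cylinder n (C : coset_space (c n)) :
  measurable (cylinder C : set (borel X)).
Proof. by apply: sub_sigma_algebra; exact: cylinder_open. Qed.

Lemma preimage_pf_coord n (A : set (coset_space (c n))) :
  pf_coord n @^-1` A = \bigcup_(C in A) cylinder C.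
Proof. by apply/seteqP; split=> [x Ax|x [C AC xC]]; [exists (pf_coord n x)|rewrite /= xC]. Qed.

Lemma finite_coset_set n (A : set (coset_space (c n))) : finite_set A.
Proof. exact: sub_finite_set (@subsetT _ _) (finite_coset_space c n). Qed.

(** [set0] is included for stability under intersection, [setT] as the exhausting set in the
    uniqueness theorem for measures. *)
Definition cylinders : set (set X) :=
  [set D | [\/ D = set0, D = setT | exists n (C : coset_space (c n)), D = cylinder C]].

(** If two cylinders meet, the one of deeper level is contained in the other. *)
Lemma cylinders_setI : setI_closed cylinders.
Proof.
have cylI m n (C : coset_space (c m)) (D : coset_space (c n)) :
    (m <= n)%N -> cylinders (cylinder C `&` cylinder D).
  move=> mn; have [->|/set0P[x [xC xD]]] := eqVneq (cylinder C `&` cylinder D) set0.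
    by apply: Or31.
  apply: Or33; exists n, D; apply/seteqP; split=> [y []//|y yD]; split=> //.
  by rewrite /cylinder /= -xC; apply: pf_coord_le mn _; rewrite yD xD.
move=> A B [->|->|[m [C ->]]]; rewrite ?set0I ?setTI//; first by move=> _; apply: Or31.
move=> [->|->|[n [D ->]]]; rewrite ?setI0 ?setIT; first by apply: Or31.
  by apply: Or33; exists m, C.
have [mn|nm] := leqP m n; first exact: cylI.
by rewrite setIC; apply: cylI; exact: ltnW.
Qed.

(** Otherwise points outside [U] that agree with [x] up to level [n] form a sequence converging to
    [x]. *)
Lemma open_contains_cylinder (U : set X) x :
  open U -> U x -> exists n, cylinder (pf_coord n x) `<=` U.
Proof.
move=> oU Ux; apply: contrapT => /forallNP xU.
have /choice[y yP] : forall n, exists y, pf_coord n y = pf_coord n x /\ ~ U y.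
  move=> n; apply: contrapT => /forallNP ny; apply: (xU n) => z zx.
  by apply: contrapT => Uz; apply: (ny z).
have yx : y n @[n --> \oo] --> x.
  apply/profinite_cvgP => n; exists n => // m nm /=.
  by have [ym _] := yP m; exact: pf_coord_le nm ym.
have [n _ nU] := yx U (open_nbhs_nbhs (conj oU Ux)).
by have [_] := yP n; apply; exact: nU (leqnn n).
Qed.

Lemma borel_cylinders : @measurable _ (borel X) = <<s cylinders >>.
Proof.
apply/seteqP; split; last first.
  apply: smallest_sub; first exact: sigma_algebra_measurable.
  move=> _ [->|->|[n [C ->]]]; [exact: measurable0|exact: measurableT|].
  exact: measurable_cylinder.
apply: smallest_sub; first exact: smallest_sigma_algebra.
move=> U oU.
(* Each level has finitely many cosets, so this is a countable union of finite unions of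
   cylinders. *)
have -> : U = \bigcup_n pf_coord n @^-1` [set C | cylinder C `<=` U].
  apply/seteqP; split=> [x Ux|x [n _ sub]]; last exact: (sub x erefl).
  by have [n] := open_contains_cylinder oU Ux; exists n.
apply: (@bigcupT_measurable _ (g_sigma_algebraType cylinders)) => n.
rewrite preimage_pf_coord.
apply: (@fin_bigcup_measurable _ (g_sigma_algebraType cylinders)).
  exact: finite_coset_set.
by move=> C _; apply: sub_sigma_algebra; apply: Or33; exists n, C.
Qed.

End profinite_cylinders.

Section profinite_measures.
Variables (R : realType) (Gamma : groupType) (c : finite_index_chain Gamma).
Local Notation X := (profinite_space c).

Lemma profinite_measure_unique (m1 m2 : {measure set (borel X) -> \bar R}%R) :
  (m1 setT < +oo)%E -> m1 setT = m2 setT ->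
  (forall n (C : coset_space (c n)), m1 (cylinder C) = m2 (cylinder C)) ->
  forall A, measurable A -> m1 A = m2 A.
Proof.
move=> m1T m12T m12 A mA.
apply: (@measure_unique _ R (borel X) (@cylinders _ c) (fun=> setT) _ _ _ _ m1 m2 _ _ A mA).
- exact: borel_cylinders.
- exact: cylinders_setI.
- by move=> _; apply: Or32.
- by rewrite bigcup_const.
- by move=> _ [->|->|[n [C ->]]//]; rewrite ?measure0.
- by [].
Qed.

End profinite_measures.

(** * Invariance and ergodicity of the uniform measure *)

Section invariance.
Variables (R : realType) (Gamma : groupType) (c : finite_index_chain Gamma).
Local Notation X := (profinite_space c).
Local Notation index n := #|` fset_set [set: coset_space (c n)]|.
Implicit Type mu : probability (borel X) R.

Lemma index_gt0 n : (0 < index n)%N.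
Proof.
rewrite lt0n cardfs_eq0; apply/eqP => /(fset_set_set0 (finite_coset_space c n)).
by apply/eqP/set0P; exists (coset_of_elt (c n) 1).
Qed.

Definition uniform_on_cylinders mu :=
  forall n (C : coset_space (c n)), mu (cylinder C) = ((index n)%:R^-1)%:E%R.

Lemma uniform_on_cylinders_inverse_limit mu :
  uniform_on_cylinders mu -> inverse_limit_of_uniform mu.
Proof.
move=> muC n A; have finA := finite_coset_set A.
rewrite preimage_pf_coord (measure_fin_bigcup mu finA); last 2 first.
- by move=> C D _ _ [x [<- <-]].
- by move=> C _; exact: measurable_cylinder.
rewrite fsbig_finite//= (eq_bigr (fun=> ((index n)%:R^-1)%:E%R)); last by move=> C _; exact: muC.
by rewrite sumEFin big_const_seq/= count_predT iter_addr_0 mulr_natl.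
Qed.

Lemma measurable_profinite_act g :
  measurable_fun setT (profinite_act g : borel X -> borel X).
Proof.
apply: (@measurability _ _ (borel X) (borel X) setT _ (@open X)) => //.
move=> _ [U oU <-]; rewrite setTI; apply: sub_sigma_algebra.
by move/continuousP: (@profinite_act_continuous _ c g); exact.
Qed.

Lemma preimage_act_cylinder g n (C : coset_space (c n)) :
  profinite_act g @^-1` cylinder C = cylinder (coset_translate g^-1 C).
Proof.
have [y ->] := coset_of_elt_onto C.
rewrite coset_translate_elt; apply/seteqP; split=> x; rewrite /cylinder /=.
  have [z xz] := pf_coord_representative x n.
  rewrite pf_coord_act xz// coset_translate_elt => /coset_of_elt_eqP gzy.
  by apply/coset_of_elt_eqP; rewrite mulgA -invgM.
by rewrite pf_coord_act => ->; rewrite coset_translate_elt mulVKg.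
Qed.

(** Each group element permutes the cylinders of a level, so [mu] and its push-forward agree on a
    generating family stable under intersection. *)
Lemma uniform_on_cylinders_invariant mu :
  uniform_on_cylinders mu -> invariant_measure (@profinite_act _ c) mu.
Proof.
move=> muC g A mA.
pose f : {mfun borel X >-> borel X}%R := mfun_Sub (mem_set (measurable_profinite_act g)).
apply: (@profinite_measure_unique R _ c (distribution mu f) mu) => //.
- exact: le_lt_trans (@probability_le1 _ _ _ (distribution mu f) _ measurableT) (ltry _).
- move=> n C; rewrite -[LHS]/(mu (profinite_act g @^-1` cylinder C)).
  by rewrite preimage_act_cylinder muC; exact: esym (muC n C).
Qed.

(** Serves twice: with [A] the whole space it yields uniformity, with [A] invariant it yields
    independence from cylinders. *)
Lemma cylinder_equidistribution mu (A : set (borel X)) n (C : coset_space (c n)) :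
  measurable A ->
  (forall D : coset_space (c n), mu (cylinder D `&` A) = mu (cylinder C `&` A)) ->
  mu (cylinder C `&` A) = (mu A * ((index n)%:R^-1)%:E%R)%E.
Proof.
move=> mA muAC.
have mCA (D : coset_space (c n)) : measurable (cylinder D `&` A : set (borel X)).
  by apply: measurableI => //; exact: measurable_cylinder.
have -> : mu A = (\sum_(D \in [set: coset_space (c n)]) mu (cylinder D `&` A))%E.
  rewrite -(measure_fin_bigcup mu (finite_coset_space c n)) => [|D E _ _|D _].
  - by rewrite -setI_bigcupl -preimage_pf_coord preimage_setT setTI.
  - by move=> [x [[<- _] [<- _]]].
  - exact: mCA.
rewrite (fsbig_finite _ _ (finite_coset_space c n))/=.
rewrite (eq_bigr (fun=> mu (cylinder C `&` A))); last by move=> D _; exact: muAC.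
have -> : mu (cylinder C `&` A) = (fine (mu (cylinder C `&` A)))%:E.
  by rewrite fineK// fin_num_measure.
rewrite sumEFin big_const_seq/= count_predT iter_addr_0 -EFinM.
by rewrite -(mulr_natr (fine _)) mulfK// pnatr_eq0 -lt0n index_gt0.
Qed.

Lemma constant_on_cylinders_uniform mu :
  (forall n (C D : coset_space (c n)), mu (cylinder C) = mu (cylinder D)) ->
  uniform_on_cylinders mu.
Proof.
move=> muCD n C; rewrite -[cylinder C]setIT.
rewrite cylinder_equidistribution ?probability_setT ?mul1e// => D.
by rewrite !setIT; exact: muCD.
Qed.

Lemma invariant_cylinder mu (A : set (borel X)) n (C D : coset_space (c n)) :
  invariant_measure (@profinite_act _ c) mu -> measurable A ->
  (forall g, profinite_act g @^-1` A = A) ->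
  mu (cylinder C `&` A) = mu (cylinder D `&` A).
Proof.
move=> inv mA Ainv.
have [x ->] := coset_of_elt_onto C; have [y ->] := coset_of_elt_onto D.
rewrite -(inv (x * y^-1)) ?preimage_setI ?Ainv ?preimage_act_cylinder; last first.
  by apply: measurableI => //; exact: measurable_cylinder.
by rewrite coset_translate_elt invgM invgK -mulgA mulVg mulg1.
Qed.

(** An invariant [A] is independent of every cylinder, since the action is transitive on each level.
    By uniqueness of measures it is independent of every Borel set, in particular of itself, so
    [mu A] equals its square. *)
Lemma uniform_on_cylinders_ergodic mu :
  uniform_on_cylinders mu -> ergodic_measure (@profinite_act _ c) mu.
Proof.
move=> muC; have inv := uniform_on_cylinders_invariant muC; split=> // A mA Ainv.
have muAC n (C : coset_space (c n)) : mu (cylinder C `&` A) = (mu A * mu (cylinder C))%E.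
  rewrite (cylinder_equidistribution mA) ?muC// => D.
  exact: invariant_cylinder.
have muAA : mu A = (mu A * mu A)%E.
  have fA : mu A = (fine (mu A))%:E by rewrite fineK// fin_num_measure.
  have fA0 : (0 <= fine (mu A))%R by exact: fine_ge0.
  transitivity (mscale (NngNum fA0) mu A); last by rewrite /mscale /= -fA.
  rewrite -[LHS]/(mu A) -{1}[A]setIid.
  apply: (@profinite_measure_unique R _ c (mrestr mu mA) (mscale (NngNum fA0) mu)) => //.
  - by rewrite /= /mrestr setTI fA ltry.
  - by rewrite /= /mrestr /mscale /= setTI probability_setT mule1 -fA.
  - by move=> n C; rewrite /= /mrestr /mscale /= -fA muAC.
have fA : mu A = (fine (mu A))%:E by rewrite fineK// fin_num_measure.
move: muAA; rewrite fA -EFinM => -[] /eqP; rewrite eq_sym -subr_eq0 -{3}[fine _]mulr1 -mulrBr.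
by rewrite mulf_eq0 subr_eq0 => /orP[] /eqP ->; [left|right].
Qed.

End invariance.

(** * Lexicographic numbering of cosets *)

Section mixed_radix.
Variables (Gamma : groupType) (c : finite_index_chain Gamma).
Local Notation X := (profinite_space c).

(** Numbers the cosets of [K] that meet [A]. With [A] everything it gives the leading digit, with
    [A] equal to [c n] and [K] to [c n.+1] the digit added at the next level. *)
Lemma relative_coset_numbering (A K : set Gamma) :
  A !=set0 -> finite_set (left_cosets K) -> 
  (forall x y, left_coset K x = left_coset K y <-> K (x^-1 * y)) ->
  exists (d : nat) (s : Gamma -> nat),
  [/\ (0 < d)%N, forall x, A x -> (s x < d)%N,
      forall j, (j < d)%N -> exists2 x, A x & s x = j &
      forall x y, A x -> A y -> s x = s y <-> K (x^-1 * y)].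
Proof.
move=> [a Aa] finK cosetP.
pose F := fset_set [set left_coset K x | x in A].
have FE C : (C \in F) = (C \in [set left_coset K x | x in A]).
  rewrite in_fset_set//; apply: sub_finite_set finK => _ [x _ <-].
  by exists x.
have FA x : A x -> left_coset K x \in F.
  by move=> Ax; rewrite FE inE; exists x.
exists #|` F|, (fun x => index (left_coset K x) F); split.
- by rewrite cardfs_gt0; apply/fset0Pn; exists (left_coset K a); exact: FA.
- by move=> x /FA; rewrite index_mem.
- move=> j jF; have := mem_nth set0 jF; rewrite -[_ \in _]/(_ \in F) FE inE => -[x Ax xj].
  by exists x => //; rewrite xj index_uniq// fset_uniq.
- move=> x y Ax Ay; split=> [xy|/cosetP ->//]; apply/cosetP.
  by rewrite -(nth_index set0 (FA x Ax)) xy nth_index//; exact: FA.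
Qed.

(* [r n.+1] refines [r n] lexicographically, so that [floor (t * N n)] determines
   a coherent sequence of cosets for every [t] in [[0, 1[]. *)
Lemma mixed_radix_numbering : exists (N d : nat -> nat) (r : nat -> Gamma -> nat),
  [/\ forall n, (0 < d n)%N /\ N n.+1 = (N n * d n)%N,
      forall n x, (r n x < N n)%N,
      forall n j, (j < N n)%N -> exists x, r n x = j,
      forall n x y, r n x = r n y <-> c n (x^-1 * y) &
      forall n x, r n x = (r n.+1 x %/ d n)%N].
Proof.
have cosetP n x y : left_coset (c n) x = left_coset (c n) y <-> c n (x^-1 * y).
  rewrite -coset_of_elt_eqP; split=> [?|]; first exact: coset_val_inj.
  by move=> /(congr1 (@coset_val _ _)).
have [N0 [r0 [N0_gt0 r0_lt r0_onto r0P]]] := relative_coset_numbering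
  (ex_intro setT 1 Logic.I) (chain_index c 0) (cosetP 0%N).
have /choice[d /choice[s sP]] n := relative_coset_numbering
  (ex_intro (c n) 1 (chain1 c n)) (chain_index c n.+1) (cosetP n.+1).
(* A fixed representative of each coset of [c n] moves that coset into [c n], where [s n] can read
   the next digit. *)
have /choice[rep repP] n : exists rep : Gamma -> Gamma,
    forall x, c n ((rep x)^-1 * x) /\ forall y, c n (x^-1 * y) -> rep x = rep y.
  exists (fun x => projT1 (cid (coset_valP (coset_of_elt (c n) x)))) => x.
  split=> [|y /coset_of_elt_eqP <-//].
  by case: cid => z /= xz; apply/cosetP; rewrite -xz.
pose N := fix N n := if n is m.+1 then (N m * d m)%N else N0.
pose r := fix r n x := if n is m.+1 then (r m x * d m + s m ((rep m x)^-1 * x)%g)%N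
                       else r0 x.
have d_gt0 n : (0 < d n)%N by have [] := sP n.
have s_lt n x : (s n ((rep n x)^-1 * x)%g < d n)%N.
  by have [_ + _ _] := sP n; apply; have [] := repP n x.
have rdiv n x : r n x = (r n.+1 x %/ d n)%N.
  by rewrite /= divnMDl// divn_small ?addn0.
have rP n x y : r n x = r n y <-> c n (x^-1 * y).
  elim: n x y => [|n IHn] x y; first by apply: r0P.
  have [_ _ _ sP'] := sP n.
  have [cx xrep] := repP n x; have [cy _] := repP n y.
  have key : c n (x^-1 * y) -> s n ((rep n x)^-1 * x) = s n ((rep n y)^-1 * y) <->
      c n.+1 (x^-1 * y).
    move=> cxy; rewrite (xrep y cxy) in cx *.
    by rewrite sP'// invgM invgK mulgA -(mulgA x^-1) mulgV mulg1.
  split=> [xy|cxy].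
    have rxy : r n x = r n y by rewrite !(rdiv n) xy.
    have /IHn cxy := rxy; apply/(key cxy).
    by move: xy => /= ; rewrite rxy => /addnI.
  have cnxy := chain_sub cxy.
  have /IHn rxy := cnxy.
  by rewrite /= rxy; congr addn; apply/(key cnxy).
exists N, d, r; split=> //.
- elim=> [|n IHn] x /=; first exact: r0_lt.
  by rewrite -ltn_divLR// divnMDl// divn_small// addn0.
- elim=> [|n IHn] j /=; first by move=> /r0_onto[x _ <-]; exists x.
  rewrite -ltn_divLR// => /IHn[x rx].
  have [_ _ s_onto _] := sP n.
  have [g cg sg] := s_onto _ (ltn_pmod j (d_gt0 n)).
  have [crx repx] := repP n x.
  (* Here [x] realizes the quotient of [j] by [d n] and [g] the remainder; [rep n x * g] keeps the
     coset of [x] modulo [c n]. *)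
  have cz : c n (x^-1 * (rep n x * g)).
    rewrite mulgA; apply: chainM => //.
    by have := chainV crx; rewrite invgM invgK.
  exists (rep n x * g).
  rewrite -(repx _ cz) mulKg sg -(iffRL (rP _ _ _) cz) rx.
  by rewrite -divn_eq.
Qed.

End mixed_radix.

(** * Existence of the uniform measure *)

Section unit_interval.
Variable R : realType.
Local Open Scope ring_scope.

Definition unit_interval_measure :=
  mrestr (@lebesgue_measure R) (measurable_itv `[0 : R, 1[).

HB.instance Definition _ := Measure.on unit_interval_measure.

Let unit_interval_measure_setT : unit_interval_measure [set: _] = 1%E.
Proof.
by rewrite /unit_interval_measure /mrestr setTI lebesgue_measure_itv /= lte_fin ltr01 sube0.
Qed.

HB.instance Definition _ := Measure_isProbability.Build _ _ _
  unit_interval_measure unit_interval_measure_setT.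

End unit_interval.

Section uniform_measure_existence.
Variables (R : realType) (Gamma : groupType) (c : finite_index_chain Gamma).
Local Notation X := (profinite_space c).

(** This is what makes the cosets read off at successive levels coherent. *)
Lemma truncn_divn (x : R) d : (0 <= x)%R -> (0 < d)%N ->
  Num.truncn x = (Num.truncn (x * d%:R) %/ d)%N.
Proof.
move=> x0 d0; apply: truncn_def.
have xd0 : (0 <= x * d%:R)%R by rewrite mulr_ge0.
have /andP[lo hi] := truncn_itv xd0.
have d0R : (0 < d%:R :> R)%R by rewrite ltr0n.
rewrite -(ler_pM2r d0R) -(ltr_pM2r d0R) -!natrM.
apply/andP; split; first by apply: le_trans lo; rewrite ler_nat leq_divM.
by apply: lt_le_trans hi _; rewrite ler_nat -ltn_divLR.
Qed.

Lemma truncn_lt_nat_unit (t : R) N : (0 <= t < 1)%R -> (0 < N)%N ->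
  (Num.truncn (t * N%:R) < N)%N.
Proof.
move=> /andP[t0 t1] N0; rewrite truncn_lt_nat ?mulr_ge0//.
by rewrite -{2}[N%:R%R]mul1r ltr_pM2r// ltr0n.
Qed.

Lemma uniform_on_cylinders_exists :
  exists mu : probability (borel X) R, uniform_on_cylinders mu.
Proof.
have [N [d [r [Nd r_lt r_onto rP rdiv]]]] := mixed_radix_numbering c.
have N_gt0 n : (0 < N n)%N by exact: leq_ltn_trans (leq0n _) (r_lt n 1).
(* The measure lives on all of [R], so [f] needs values outside the unit interval; a constant one
   keeps it measurable. *)
have /choice[f fP] : forall t : R, exists x : X,
    ((0 <= t < 1)%R -> forall n y, pf_coord n x = coset_of_elt (c n) y <->
       Num.truncn (t * (N n)%:R) = r n y) /\
    (~ (0 <= t < 1)%R -> x = point).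
  move=> t; have [t01|t01] := pselect (0 <= t < 1)%R; last by exists point.
  have /choice[z zP] n : exists z, r n z = Num.truncn (t * (N n)%:R).
    by apply: r_onto; exact: truncn_lt_nat_unit.
  have zc n : chain_quot (coset_of_elt (c n.+1) (z n.+1)) = coset_of_elt (c n) (z n).
    rewrite chain_quotE; apply/coset_of_elt_eqP/rP.
    have [d0 Nnd] := Nd n; have /andP[t0 _] := t01.
    by rewrite rdiv !zP Nnd natrM mulrA -truncn_divn// mulr_ge0.
  exists (Coherent zc); split=> // _ n y.
  by rewrite -zP (rP n); exact: coset_of_elt_eqP.
have fcyl n y : f @^-1` cylinder (coset_of_elt (c n) y) `&` `[0%R, 1%R[ =
    `[((r n y)%:R / (N n)%:R)%R, ((r n y).+1%:R / (N n)%:R)%R[%classic.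
  have N0 : (0 < (N n)%:R :> R)%R by rewrite ltr0n.
  apply/seteqP; split=> t /=; rewrite !in_itv /= ler_pdivrMr// ltr_pdivlMr//.
    move=> [ft t01]; have [/(_ t01 n y)[/(_ ft) <- _] _] := fP t.
    by apply: truncn_itv; case/andP: t01 => t0 _; rewrite mulr_ge0.
  move=> /[dup] trn /andP[lo hi].
  have t0 : (0 <= t)%R by rewrite -(pmulr_lge0 _ N0); exact: le_trans lo.
  have t01 : (0 <= t < 1)%R.
    rewrite t0 -(ltr_pM2r N0) mul1r; apply: lt_le_trans hi _.
    by rewrite ler_nat; exact: r_lt.
  split=> //; have [/(_ t01 n y)[_ +] _] := fP t; apply.
  exact: truncn_def.
have mf : measurable_fun setT (f : measurableTypeR R -> borel X).
  apply: (@measurability _ _ (measurableTypeR R) (borel X) setT f _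
    (borel_cylinders c)) => _ [U + <-].
  rewrite setTI => -[->|->|[n [C ->]]]; rewrite ?preimage_set0 ?preimage_setT//.
  have [y ->] := coset_of_elt_onto C.
  rewrite -[X in measurable X](setUIDK _ `[0%R, 1%R[%classic).
  apply: measurableU; first by rewrite fcyl; exact: measurable_itv.
  have outside t : ~ (0 <= t < 1)%R -> f t = point by have [] := fP t.
  have [pC|pC] := pselect (cylinder (coset_of_elt (c n) y) point).
    rewrite (_ : _ `\` _ = ~` `[0%R, 1%R[); first by apply: measurableC; exact: measurable_itv.
    apply/seteqP; split=> t /=; rewrite in_itv /=; first by case.
    by move=> t01; split=> //; rewrite outside.
  rewrite (_ : _ `\` _ = set0); first exact: measurable0.
  apply/seteqP; split=> t //= []; rewrite in_itv /= => + t01.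
  by rewrite outside.
pose F : {mfun measurableTypeR R >-> borel X}%R := mfun_Sub (mem_set mf).
exists (distribution (@unit_interval_measure R) F).
(* Equal masses within a level suffice, so [N n] need not be identified with the index. *)
apply: constant_on_cylinders_uniform => n.
suff muC (C : coset_space (c n)) :
    distribution (@unit_interval_measure R) F (cylinder C) = ((N n)%:R^-1)%:E%R.
  by move=> C D; exact: etrans (muC C) (esym (muC D)).
have [y ->] := coset_of_elt_onto C.
rewrite -[LHS]/(lebesgue_measure (f @^-1` cylinder (coset_of_elt (c n) y) `&` `[0%R, 1%R[)).
rewrite fcyl lebesgue_measure_itv /= lte_fin.
rewrite ltr_pM2r ?invr_gt0 ?ltr0n// ltr_nat ltnSn.
by rewrite -EFinB -mulrBl -natrB// subSnn mul1r.
Qed.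

End uniform_measure_existence.

(** * Topological freeness *)

Lemma profinite_topologically_free (Gamma : groupType) (c : finite_index_chain Gamma) :
  topologically_free (@profinite_act _ c).
Proof.
move=> g g1 U [x Ux] oU.
have [n nU] := open_contains_cylinder oU Ux.
have [y xy] := pf_coord_representative x n.
exists (profinite_of_elt c y); split.
  by apply: nU; rewrite /cylinder /= xy.
move=> gy; apply/negP: g1; rewrite negbK; apply/eqP.
(* If [g] fixes the image of [y], this conjugate lies in every [c m]. *)
suff : (y^-1 * g * y) = 1.
  by move=> /(congr1 (fun z => y * z * y^-1)); rewrite !mulgA mulgV mul1g mulgK mulg1 mulgV.
suff : [set 1] (y^-1 * g * y) by [].
rewrite -(chain_cap c) => m _; rewrite -mulgA; apply/coset_of_elt_eqP.
by rewrite -coset_translate_elt; exact: esym (congr1 (pf_coord m) gy).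
Qed.

(** * Failure of essential freeness *)

Section non_essentially_free.
Variables (R : realType) (G H : groupType) (c : finite_index_chain (wreath G H)).
Variables (K : nat -> set H) (e t : nat -> H) (a : G).
Local Notation X := (profinite_space c).
Hypotheses (G_abelian : abelian_group G) (a_neq1 : a != 1).
Hypothesis finK : forall i, finite_quotient_kernel (K i).
Hypothesis t_coset : forall i j k, (j < 2 ^ i.+2)%N -> (k < 2 ^ i.+2)%N ->
  j != k -> ~ K i ((t j)^-1 * t k).
Hypothesis chain_top : forall i w, c i.+1 w -> K i (wr_top w).
Hypothesis chain_delta : forall n, exists N, forall h,
  ~ c n (Wreath (c00_delta h a) 1) -> exists2 i, (i < N)%N & K i ((e i)^-1 * h).

Let delta : wreath G H := Wreath (c00_delta 1 a) 1.

(* The points of [H]-part [h] with [h^-1] in [e_i K_i]; the [H]-part is only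
   defined modulo [K_i]. *)
Let moved_zone i : set X :=
  pf_coord i.+1 @^-1` [set C | exists2 y, C = coset_of_elt (c i.+1) y & K i (wr_top y * e i)].

Lemma moved_zone_cover : [set x | profinite_act delta x <> x] `<=` \bigcup_i moved_zone i.
Proof.
move=> x xmoved.
have [n xn] : exists n, pf_coord n (profinite_act delta x) <> pf_coord n x.
  by apply/existsNP => xE; apply: xmoved; exact: pf_coord_inj.
have [N NP] := chain_delta n.
(* Level [n] detects the motion; level [N] is deep enough to test every zone [i < N], which is
   defined at level [i.+1]. *)
have [y xy] := pf_coord_representative x (maxn n N).
have : ~ c n (Wreath (c00_delta (wr_top y)^-1 a) 1).
  rewrite -wreath_delta_conj// => cy; apply: xn.
  rewrite pf_coord_act xy ?leq_maxl// coset_translate_elt.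
  apply/esym/coset_of_elt_eqP.
  by rewrite mulgA.
move=> /NP[i iN Kiy]; exists i => //=; exists y.
  by apply: xy; exact: leq_trans iN (leq_maxr _ _).
have := finite_quotient_kernelV (finK i) Kiy.
by rewrite invgM !invgK.
Qed.

Lemma measurable_moved_zone i : measurable (moved_zone i : set (borel X)).
Proof.
rewrite /moved_zone preimage_pf_coord; apply: fin_bigcup_measurable; first exact: finite_coset_set.
by move=> C _; exact: measurable_cylinder.
Qed.

(** The bound is [2^-(i+2)], written in the shape that [epsilon_trick0] sums to [2^-1]. *)
Lemma moved_zone_measure (mu : probability (borel X) R) i :
  invariant_measure (@profinite_act _ c) mu ->
  (mu (moved_zone i) <= (2^-1 / (2 ^ i.+1)%:R)%:E)%E%R.
Proof.
move=> inv.
(* The translates of [moved_zone i] by the [t j] lie over distinct cosets of [K i]. *)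
pose F (j : 'I_(2 ^ i.+2)) : set X := profinite_act (Wreath 1 (t j))^-1 @^-1` moved_zone i.
have mF j : measurable (F j : set (borel X)).
  rewrite -[F j]setTI; apply: measurable_profinite_act => //.
  exact: measurable_moved_zone.
have tF : trivIset setT F.
  apply/trivIsetP => j k _ _ jk; apply/seteqP; split=> // x [].
  have [y xy] := pf_coord_representative x i.+1.
  rewrite /F /moved_zone /=.
  rewrite !pf_coord_act xy// !coset_translate_elt.
  move=> [v /coset_of_elt_eqP/chain_top jv Kv] [w /coset_of_elt_eqP/chain_top kw Kw].
  apply: (@t_coset i j k (ltn_ord j) (ltn_ord k)); first exact: jk.
  have [Q [f [fM Kf]]] := finK i; move: jv Kv kw Kw; rewrite Kf /=.
  rewrite !invgM !invgK /= !fM !(morph_inv fM) => jv Kv kw Kw.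
  (* A common point would give [t j] and [t k] the same image [f (wr_top y) * f (e i)]. *)
  have solve p q : (f (wr_top y))^-1 * p * q = 1 -> q * f (e i) = 1 ->
      p = f (wr_top y) * f (e i).
    move=> pq qe; have := congr1 (fun z => f (wr_top y) * (z * f (e i))) pq.
    by rewrite mul1g -!mulgA qe mulg1 mulVKg.
  by rewrite (solve _ _ jv Kv) (solve _ _ kw Kw) mulVg.
have sumF : (\sum_(j < 2 ^ i.+2) mu (F j) <= 1)%E.
  rewrite -(measure_bigsetU_ord mu xpredT mF tF).
  by apply: probability_le1; exact: bigsetU_measurable.
move: sumF; rewrite (eq_bigr (fun=> mu (moved_zone i))); last first.
  by move=> j _; apply: inv; exact: measurable_moved_zone.
rewrite -[mu (moved_zone i)]fineK ?fin_num_measure//; last exact: measurable_moved_zone.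
rewrite sumEFin sumr_const card_ord !lee_fin.
rewrite -(mulr_natr (fine _)) => mu_le.
rewrite -invfM -natrM -expnS -div1r ler_pdivlMr ?ltr0n ?expn_gt0//.
Qed.

(** Points fixed by [delta] would lie in a null set and all others lie in the zones, of total mass
    at most [2^-1], so the space would have mass less than 1. *)
Lemma not_essentially_free (mu : probability (borel X) R) :
  invariant_measure (@profinite_act _ c) mu -> ~ essentially_free (@profinite_act _ c) mu.
Proof.
move=> inv [N [mN muN sN]].
have mE := measurable_moved_zone.
have : (mu setT <= mu N + mu (\bigcup_i moved_zone i))%E.
  apply: le_trans (measureU2 _ _ _) => //; last by exact: bigcupT_measurable.
  apply: le_measure; rewrite ?inE//; first by apply: measurableU => //; exact: bigcupT_measurable.
  move=> x _; have [xfix|xmoved] := pselect (profinite_act delta x = x).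
    left; apply: sN; exists delta => //.
    apply: contra_neq a_neq1 => /(congr1 (fun w => wr_base w 1)) /=.
    by rewrite eqxx.
  by right; exact: moved_zone_cover.
rewrite muN add0e probability_setT leNgt => /negP; apply.
have mbig : measurable (\bigcup_i moved_zone i : set (borel X)).
  exact: bigcupT_measurable.
apply: le_lt_trans (le_mu_bigcup mu mE mbig) _.
apply: (@le_lt_trans _ _ (2^-1)%:E%R); last by rewrite lte_fin invf_lt1// ltr1n.
apply: le_trans (epsilon_trick0 xpredT _); last by [].
by apply: lee_nneseries => // i _; exact: moved_zone_measure.
Qed.

End non_essentially_free.

Theorem corollary11p3 (R : realType) (G H : groupType)
    (G_nontrivial : nontrivial_group G)
    (G_countable : countable [set: G])
    (G_rf : residually_finite G)
    (G_abelian : abelian_group G)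
    (H_countable : countable [set: H])
    (H_infinite : infinite_set [set: H])
    (H_rf : residually_finite H) :
  exists (c : finite_index_chain (wreath G H))
         (mu : probability (borel (profinite_space c)) R),
    [/\ inverse_limit_of_uniform mu,
        ergodic_measure (@profinite_act _ c) mu
      & allosteric (@profinite_act _ c) mu].
Proof.
have [a a1] := G_nontrivial.
have [c [K [e [t [finK tK topK deltaK]]]]] :=
  wreath_chain a G_countable G_rf G_abelian H_countable H_infinite H_rf.
have [mu muC] := uniform_on_cylinders_exists R c.
exists c, mu; split.
- exact: uniform_on_cylinders_inverse_limit.
- exact: uniform_on_cylinders_ergodic.
- split; first exact: profinite_topologically_free.
  exact: not_essentially_free tK topK deltaK _ (uniform_on_cylinders_invariant muC).
Qed.
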